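(* Let $X$ and $Y$ be abelian symmetric quandles, let $\phi\colon H(X)\to H(Y)$ be a surjective homomorphism (lying in the full subcategory $\mathsf{AbSymQnd}$), let $A$ be a quandle and let $f\colon A\to H(Y)$ be a surjective homomorphism. Let $P$, with projections $p_1\colon P\to A$ and $p_2\colon P\to H(X)$, be the pullback of $\phi$ along $f$ in $\mathsf{Qnd}$. Then the reflector $I\colon\mathsf{Qnd}\to\mathsf{AbSymQnd}$ preserves this pullback, i.e. the image under $I$ of the pullback square $\phi\circ p_2=f\circ p_1$ is a pullback square.
   Context: A quandle is a set $A$ with two binary operations $\lhd, \lhd^{-1}$ such that for all $a,b,c\in A$: $a\lhd a=a=a\lhd^{-1}a$; $(a\lhd b)\lhd^{-1}b=a=(a\lhd^{-1}b)\lhd b$; $(a\lhd b)\lhd c=(a\lhd c)\lhd(b\lhd c)$ and $(a\lhd^{-1} b)\lhd^{-1} c=(a\lhd^{-1} c)\lhd^{-1}(b\lhd^{-1} c)$. Homomorphisms preserve both operations; the resulting category (a variety of universal algebras) is $\mathsf{Qnd}$. A quandle is symmetric if $a\lhd b=b\lhd a$ for all $a,b$, and abelian if $(a\lhd b)\lhd(c\lhd d)=(a\lhd c)\lhd(b\lhd d)$ for all $a,b,c,d$. $\mathsf{AbSymQnd}$ is the full subcategory (subvariety) of quandles that are both abelian and symmetric; $H\colon \mathsf{AbSymQnd}\to\mathsf{Qnd}$ is the inclusion and $I\colon\mathsf{Qnd}\to\mathsf{AbSymQnd}$ is its left adjoint (the reflector). *)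

(* Defs.v *)
From HB Require Import structures.
From mathcomp Require Import all_boot.
From mathcomp Require Import boolp.

Set Implicit Arguments.
Unset Strict Implicit.
Unset Printing Implicit Defensive.

Record category := Category {
  obj :> Type;
  hom : obj -> obj -> Type;
  idm : forall A, hom A A;
  comp : forall A B C, hom B C -> hom A B -> hom A C;
  comp1m : forall A B (f : hom A B), comp (idm B) f = f;
  compm1 : forall A B (f : hom A B), comp f (idm A) = f;
  compmA : forall A B C D (h : hom C D) (g : hom B C) (f : hom A B),
    comp h (comp g f) = comp (comp h g) f
}.

Arguments hom {c} A B.
Arguments idm {c} A.
Arguments comp {c A B C} g f.

Record functor (C D : category) := Functor {
  fobj :> C -> D;
  fmap : forall A B, hom A B -> hom (fobj A) (fobj B);
  fmap1 : forall A, fmap (idm A) = idm (fobj A);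
  fmapM : forall A B E (g : hom B E) (f : hom A B),
    fmap (comp g f) = comp (fmap g) (fmap f)
}.

Arguments fmap {C D} F {A B} f : rename.

Record adjunction (C D : category) (F : functor C D) (G : functor D C) :=
Adjunction {
  adj : forall (A : C) (B : D), hom (F A) B -> hom A (G B);
  adj_bij : forall A B, bijective (@adj A B);
  adj_naturall : forall (A A' : C) (B : D) (f : hom (F A) B) (a : hom A' A),
    adj (comp f (fmap F a)) = comp (adj f) a;
  adj_naturalr : forall (A : C) (B B' : D) (f : hom (F A) B) (b : hom B B'),
    adj (comp b f) = comp (fmap G b) (adj f)
}.

Definition left_adjoint (C D : category) (F : functor C D) (G : functor D C) :=
  inhabited (adjunction F G).

Definition is_pullback (C : category) (A B Z P : C)
    (f : hom A Z) (g : hom B Z) (p1 : hom P A) (p2 : hom P B) :=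
  comp f p1 = comp g p2 /\
  forall (Q : C) (q1 : hom Q A) (q2 : hom Q B), comp f q1 = comp g q2 ->
    exists! u : hom Q P, comp p1 u = q1 /\ comp p2 u = q2.

Section FullSubcategory.
Variables (C : category) (S : C -> Prop).

Definition full_subcategory : category := {|
  obj := {A : C | S A};
  hom A B := hom (sval A) (sval B);
  idm A := idm (sval A);
  comp A B E g f := comp g f;
  comp1m A B f := comp1m f;
  compm1 A B f := compm1 f;
  compmA A B E F h g f := compmA h g f
|}.

Definition full_inclusion : functor full_subcategory C := {|
  fobj (A : full_subcategory) := sval A;
  fmap A B f := f;
  fmap1 A := erefl;
  fmapM A B E g f := erefl
|}.

End FullSubcategory.

Declare Scope quandle_scope.
Delimit Scope quandle_scope with qnd.
Local Open Scope quandle_scope.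

Reserved Notation "a \lhd b" (at level 40, left associativity).
Reserved Notation "a \lhdV b" (at level 40, left associativity).

HB.mixin Record isQuandle A := {
  lhd : A -> A -> A;
  lhdV : A -> A -> A;
  lhdxx : forall a, lhd a a = a;
  lhdVxx : forall a, lhdV a a = a;
  lhdK : forall a b, lhdV (lhd a b) b = a;
  lhdVK : forall a b, lhd (lhdV a b) b = a;
  lhdD : forall a b c, lhd (lhd a b) c = lhd (lhd a c) (lhd b c);
  lhdVD : forall a b c, lhdV (lhdV a b) c = lhdV (lhdV a c) (lhdV b c)
}.

#[short(type="quandleType")]
HB.structure Definition Quandle := {A of isQuandle A}.

Notation "a \lhd b" := (lhd a b) : quandle_scope.
Notation "a \lhdV b" := (lhdV a b) : quandle_scope.

HB.mixin Record isQuandleHom (A B : quandleType) (f : A -> B) := {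
  qhom_lhd : {morph f : a b / a \lhd b};
  qhom_lhdV : {morph f : a b / a \lhdV b}
}.

HB.structure Definition QuandleHom (A B : quandleType) :=
  {f of isQuandleHom A B f}.

Notation "{ 'qhom' A -> B }" := (QuandleHom.type A B)
  (at level 0, A at level 98, B at level 99, format "{ 'qhom'  A  ->  B }").

Lemma qhom_eqP (A B : quandleType) (f g : {qhom A -> B}) : f = g <-> f =1 g.
Proof.
split=> [-> //|]; case: f g => f [[fM fV]] [g [[gM gV]]] /= /funext fg.
move: gM gV; rewrite -{}fg => gM gV.
by rewrite (Prop_irrelevance fM gM) (Prop_irrelevance fV gV).
Qed.

Section QuandleHomInstances.
Variables A B C : quandleType.

Fact qid_lhd : {morph (idfun : A -> A) : a b / a \lhd b}.
Proof. by []. Qed.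
Fact qid_lhdV : {morph (idfun : A -> A) : a b / a \lhdV b}.
Proof. by []. Qed.
HB.instance Definition _ := isQuandleHom.Build A A idfun qid_lhd qid_lhdV.

Variables (g : {qhom B -> C}) (f : {qhom A -> B}).

Fact qcomp_lhd : {morph g \o f : a b / a \lhd b}.
Proof. by move=> a b /=; rewrite !qhom_lhd. Qed.
Fact qcomp_lhdV : {morph g \o f : a b / a \lhdV b}.
Proof. by move=> a b /=; rewrite !qhom_lhdV. Qed.
HB.instance Definition _ :=
  isQuandleHom.Build A C (g \o f) qcomp_lhd qcomp_lhdV.

End QuandleHomInstances.

Definition Qnd : category.
Proof.
refine (@Category quandleType (fun A B => {qhom A -> B})
  (fun A => idfun : {qhom A -> A})
  (fun A B C g f => g \o f : {qhom A -> C}) _ _ _);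
  by move=> *; apply/qhom_eqP.
Defined.

Definition symmetric_quandle (A : quandleType) :=
  forall a b : A, a \lhd b = b \lhd a.

Definition abelian_quandle (A : quandleType) :=
  forall a b c d : A, (a \lhd b) \lhd (c \lhd d) = (a \lhd c) \lhd (b \lhd d).

Definition AbSymQnd : category :=
  full_subcategory
    (fun A : Qnd => abelian_quandle A /\ symmetric_quandle A).

Definition AbSymQnd_incl : functor AbSymQnd Qnd := full_inclusion _.

Definition qsurjective (A B : quandleType) (f : {qhom A -> B}) :=
  forall b : B, exists a : A, f a = b.

Section Reflector.
Variable A : quandleType.

(* The least congruence on A with abelian symmetric quotient, given as the
   intersection of the kernel pairs of all homomorphisms to such quandles. *)
Let R (a b : A) : Prop :=
  forall (B : AbSymQnd) (h : {qhom A -> sval B}), h a = h b.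

Definition reflection : Type := {S : A -> Prop | exists a, S = R a}.

Definition refl_class (a : A) : reflection := exist _ (R a) (ex_intro _ a erefl).

Definition refl_repr (u : reflection) : A := sval (cid (svalP u)).

Let refl_reprK u : refl_class (refl_repr u) = u.
Proof.
rewrite /refl_repr; case: cid => a /=.
by case: u => S /= ? e; apply/eq_exist; rewrite e.
Qed.

Lemma refl_class_eq (a b : A) : refl_class a = refl_class b <-> R a b.
Proof.
split=> [/(congr1 sval) /= e|Rab].
  by rewrite e => B h.
by apply/eq_exist/funext => c; apply/propext; split=> + B h => /(_ B h) <-.
Qed.

Let opq (op : A -> A -> A) (u v : reflection) : reflection :=
  refl_class (op (refl_repr u) (refl_repr v)).

Lemma refl_repr_class a (B : AbSymQnd) (h : {qhom A -> sval B}) :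
  h (refl_repr (refl_class a)) = h a.
Proof. by move: B h; apply/refl_class_eq; rewrite refl_reprK. Qed.

Let classM a b : refl_class (a \lhd b) = opq lhd (refl_class a) (refl_class b).
Proof. by apply/refl_class_eq => B h; rewrite !qhom_lhd !refl_repr_class. Qed.

Let classMV a b :
  refl_class (a \lhdV b) = opq lhdV (refl_class a) (refl_class b).
Proof. by apply/refl_class_eq => B h; rewrite !qhom_lhdV !refl_repr_class. Qed.

Let oxx u : opq lhd u u = u.
Proof. by rewrite -[u]refl_reprK -classM lhdxx. Qed.
Let oVxx u : opq lhdV u u = u.
Proof. by rewrite -[u]refl_reprK -classMV lhdVxx. Qed.
Let oK u v : opq lhdV (opq lhd u v) v = u.
Proof. by rewrite -[u]refl_reprK -[v]refl_reprK -classM -classMV lhdK. Qed.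
Let oVK u v : opq lhd (opq lhdV u v) v = u.
Proof. by rewrite -[u]refl_reprK -[v]refl_reprK -classMV -classM lhdVK. Qed.
Let oD u v w : opq lhd (opq lhd u v) w = opq lhd (opq lhd u w) (opq lhd v w).
Proof.
by rewrite -[u]refl_reprK -[v]refl_reprK -[w]refl_reprK -!classM lhdD.
Qed.
Let oVD u v w :
  opq lhdV (opq lhdV u v) w = opq lhdV (opq lhdV u w) (opq lhdV v w).
Proof.
by rewrite -[u]refl_reprK -[v]refl_reprK -[w]refl_reprK -!classMV lhdVD.
Qed.

HB.instance Definition _ :=
  isQuandle.Build reflection oxx oVxx oK oVK oD oVD.

HB.instance Definition _ :=
  isQuandleHom.Build A reflection refl_class classM classMV.

Lemma reflection_abelian : abelian_quandle reflection.
Proof.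
move=> a b c d; rewrite -[a]refl_reprK -[b]refl_reprK -[c]refl_reprK.
rewrite -[d]refl_reprK -!qhom_lhd; apply/refl_class_eq => B h.
by rewrite !qhom_lhd; case: (svalP B) => + _; apply.
Qed.

Lemma reflection_symmetric : symmetric_quandle reflection.
Proof.
move=> a b; rewrite -[a]refl_reprK -[b]refl_reprK.
rewrite -!qhom_lhd; apply/refl_class_eq => B h.
by rewrite !qhom_lhd; case: (svalP B) => _; apply.
Qed.

Definition reflAbSym : AbSymQnd :=
  exist _ (reflection : Qnd) (conj reflection_abelian reflection_symmetric).

Section Lift.
Variables (B : AbSymQnd) (h : {qhom A -> sval B}).

Definition refl_lift_fun (u : reflection) : sval B := h (refl_repr u).

Let lM : {morph refl_lift_fun : u v / u \lhd v}.
Proof. by move=> u v; rewrite /refl_lift_fun refl_repr_class qhom_lhd. Qed.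
Let lMV : {morph refl_lift_fun : u v / u \lhdV v}.
Proof. by move=> u v; rewrite /refl_lift_fun refl_repr_class qhom_lhdV. Qed.

HB.instance Definition _ := isQuandleHom.Build _ _ refl_lift_fun lM lMV.

Definition refl_lift : {qhom reflection -> sval B} := refl_lift_fun.

Lemma refl_liftE a : refl_lift (refl_class a) = h a.
Proof. exact: refl_repr_class. Qed.

End Lift.

Lemma refl_ind (Pr : reflection -> Prop) :
  (forall a, Pr (refl_class a)) -> forall u, Pr u.
Proof. by move=> Pa u; rewrite -[u]refl_reprK. Qed.

End Reflector.

Lemma AbSymQnd_reflective :
  exists I : functor Qnd AbSymQnd, left_adjoint I AbSymQnd_incl.
Proof.
pose eta (A : Qnd) : @hom Qnd A (sval (reflAbSym A)) := @refl_class A.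
pose F A B (f : @hom Qnd A B) : @hom AbSymQnd (reflAbSym A) (reflAbSym B) :=
  @refl_lift A (reflAbSym B) (@comp Qnd _ _ _ (eta B) f).
have F1 (A : Qnd) : F A A (idm A) = @idm AbSymQnd (reflAbSym A).
  by apply/qhom_eqP; apply: refl_ind => a; rewrite refl_liftE.
have FM (A B C : Qnd) (g : hom B C) (f : hom A B) :
    F A C (comp g f) = comp (F B C g) (F A B f).
  apply/qhom_eqP; apply: refl_ind => a /=; symmetry.
  exact: (@refl_repr_class _ _ (reflAbSym C) (@comp Qnd _ _ _ (eta C) g)).
exists (Functor F1 FM); constructor.
pose ad (A : Qnd) (B : AbSymQnd) (h : @hom AbSymQnd (reflAbSym A) B) :
  hom A (AbSymQnd_incl B) := @comp Qnd _ _ _ h (eta A).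
apply: (@Adjunction _ _ (Functor F1 FM) AbSymQnd_incl ad).
- move=> A B; exists (@refl_lift A B) => h; apply/qhom_eqP.
    by apply: refl_ind => a; apply: refl_liftE.
  by move=> a; apply: refl_liftE.
- move=> A A' B f a; apply/qhom_eqP => x; rewrite /ad /F /=.
  exact: (@refl_repr_class _ _ B (@comp Qnd _ _ _ f (@comp Qnd _ _ _ (eta A) a))).
- by move=> A B B' f b; apply/qhom_eqP.
Qed.

(* Main.v *)
(** Write [eta] for the unit of the reflection. It is surjective, and bijective
    on abelian symmetric quandles, so the claim amounts to this: two elements
    [(a, x)] and [(a', x)] of the pullback with [eta a = eta a'] are identified
    by every homomorphism [k] from the pullback to an abelian symmetric quandle.
    The relation "[a] and [a'] have the same image in [Y] and [k (a, x) =
    k (a', x)] for all [x] above it" is a congruence on [A] with abelian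
    symmetric quotient, because an abelian symmetric quandle has division on
    both sides: when [phi] is surjective, any [x] above [f (a \lhd b)] can be
    written [y \lhd z] with [y] above [f a] and [z] above [f b]. *)

From HB Require Import structures.
From mathcomp Require Import all_boot.
From mathcomp Require Import boolp.
Require Import Defs.

Set Implicit Arguments.
Unset Strict Implicit.
Unset Printing Implicit Defensive.

Local Open Scope quandle_scope.

(** * Quotients of quandles by congruences *)

Record congruence (A : quandleType) (S : A -> A -> Prop) : Prop := Congruence {
  cong_refl : forall a, S a a;
  cong_sym : forall a b, S a b -> S b a;
  cong_trans : forall a b c, S a b -> S b c -> S a c;
  cong_lhd : forall a a' b b', S a a' -> S b b' -> S (a \lhd b) (a' \lhd b');
  cong_lhdV : forall a a' b b', S a a' -> S b b' -> S (a \lhdV b) (a' \lhdV b')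
}.

(** The quotient consists of the classes [S a] as predicates on [A]; its operations act on chosen
    representatives, and compatibility of [S] makes [cls] a homomorphism. *)
Lemma congruence_quotient (A : quandleType) (S : A -> A -> Prop) :
  congruence S ->
  exists (B : quandleType) (h : {qhom A -> B}),
    qsurjective h /\ forall a b, h a = h b <-> S a b.
Proof.
case=> S_refl S_sym S_trans S_lhd S_lhdV.
pose T := {U : A -> Prop | exists a, U = S a}.
pose cls a : T := exist _ (S a) (ex_intro _ a erefl).
pose repr (u : T) : A := sval (cid (svalP u)).
have reprK u : cls (repr u) = u.
  rewrite /repr; case: cid => a /=.
  by case: u => U /= ? e; apply/eq_exist; rewrite e.
have clsP a b : cls a = cls b <-> S a b.
  split=> [/(congr1 sval) /= e|Sab]; first by rewrite e.
  apply/eq_exist/funext => c; apply/propext; split; first exact/S_trans/S_sym.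
  exact: S_trans.
pose op (o : A -> A -> A) u v := cls (o (repr u) (repr v)).
have Srepr a : S a (repr (cls a)) by apply/clsP; rewrite reprK.
have clsM a b : cls (a \lhd b) = op lhd (cls a) (cls b).
  exact/clsP/S_lhd.
have clsMV a b : cls (a \lhdV b) = op lhdV (cls a) (cls b).
  exact/clsP/S_lhdV.
have oxx u : op lhd u u = u by rewrite -[u]reprK -clsM lhdxx.
have oVxx u : op lhdV u u = u by rewrite -[u]reprK -clsMV lhdVxx.
have oK u v : op lhdV (op lhd u v) v = u.
  by rewrite -[u]reprK -[v]reprK -clsM -clsMV lhdK.
have oVK u v : op lhd (op lhdV u v) v = u.
  by rewrite -[u]reprK -[v]reprK -clsMV -clsM lhdVK.
have oD u v w : op lhd (op lhd u v) w = op lhd (op lhd u w) (op lhd v w).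
  by rewrite -[u]reprK -[v]reprK -[w]reprK -!clsM lhdD.
have oVD u v w : op lhdV (op lhdV u v) w = op lhdV (op lhdV u w) (op lhdV v w).
  by rewrite -[u]reprK -[v]reprK -[w]reprK -!clsMV lhdVD.
pose B : quandleType := HB.pack T (isQuandle.Build T oxx oVxx oK oVK oD oVD).
pose h : {qhom A -> B} := HB.pack cls (isQuandleHom.Build A B cls clsM clsMV).
by exists B, h; split=> // u; exists (repr u); apply: reprK.
Qed.

(** Used in contrapositive spirit: elements that no homomorphism to an abelian symmetric quandle
    separates are related by every such [S]. *)
Lemma abelian_symmetric_quotient (A : quandleType) (S : A -> A -> Prop) :
    congruence S ->
    (forall a b, S (a \lhd b) (b \lhd a)) ->
    (forall a b c d,
      S ((a \lhd b) \lhd (c \lhd d)) ((a \lhd c) \lhd (b \lhd d))) ->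
  exists (B : AbSymQnd) (h : {qhom A -> sval B}), forall a b, h a = h b -> S a b.
Proof.
move=> /congruence_quotient[B [h [h_surj hP]]] Ssym Sab.
have B_ab : abelian_quandle B.
  move=> a b c d; have [[a' <-] [b' <-]] := (h_surj a, h_surj b).
  have [[c' <-] [d' <-]] := (h_surj c, h_surj d).
  by rewrite -!qhom_lhd; apply/hP.
have B_sym : symmetric_quandle B.
  move=> a b; have [[a' <-] [b' <-]] := (h_surj a, h_surj b).
  by rewrite -!qhom_lhd; apply/hP.
by exists (exist _ (B : Qnd) (conj B_ab B_sym)), h => a b /hP.
Qed.

(** * The one-element quandle and pullbacks in terms of elements *)

Fact unit_opxx (u : unit) : u = u. Proof. by []. Qed.
Fact unit_opK (u v : unit) : u = u. Proof. by []. Qed.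
Fact unit_opD (u v w : unit) : u = u. Proof. by []. Qed.
HB.instance Definition _ := @isQuandle.Build unit (fun u _ => u) (fun u _ => u)
  unit_opxx unit_opxx unit_opK unit_opK unit_opD unit_opD.

Section Point.
Variables (A : quandleType) (a : A).

Definition qpoint (_ : unit) : A := a.

Fact qpoint_lhd : {morph qpoint : u v / u \lhd v}.
Proof. by move=> u v; rewrite /qpoint lhdxx. Qed.
Fact qpoint_lhdV : {morph qpoint : u v / u \lhdV v}.
Proof. by move=> u v; rewrite /qpoint lhdVxx. Qed.
HB.instance Definition _ := isQuandleHom.Build unit A qpoint qpoint_lhd qpoint_lhdV.

End Point.

(** Elements of a quandle are homomorphisms from the one-element quandle. *)
Lemma pullbackP (A B Z P : Qnd) (f : hom A Z) (g : hom B Z)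
    (p1 : hom P A) (p2 : hom P B) :
  is_pullback f g p1 p2 <->
  [/\ forall p, f (p1 p) = g (p2 p),
      forall p p', p1 p = p1 p' -> p2 p = p2 p' -> p = p' &
      forall a b, f a = g b -> exists p, p1 p = a /\ p2 p = b].
Proof.
split=> [[/qhom_eqP pC pU]|[pC pI pS]].
- split=> // [p p' e1 e2|a b fgab].
  (* [p] and [p'] are both mediating maps for one cone on the point. *)
  + have [|u [_ uU]] := pU unit (qpoint (p1 p)) (qpoint (p2 p)).
      by apply/qhom_eqP => -[]; apply: pC.
    have up : u = qpoint p by apply: uU; split; apply/qhom_eqP => -[].
    have up' : u = qpoint p'.
      by apply: uU; split; apply/qhom_eqP => -[] /=; rewrite /qpoint.
    by move: up; rewrite up' => /qhom_eqP /(_ tt).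
  + have [|u [[/qhom_eqP u1 /qhom_eqP u2] _]] := pU unit (qpoint a) (qpoint b).
      by apply/qhom_eqP => -[]; apply: fgab.
    by exists (u tt); split; [apply: u1 | apply: u2].
- split=> [|Q q1 q2 /qhom_eqP qC]; first exact/qhom_eqP.
  (* Joint injectivity of [p1] and [p2] forces any pointwise choice to be a homomorphism, and the
     only mediating one. *)
  pose u q := sval (cid (pS _ _ (qC q))).
  have u1 q : p1 (u q) = q1 q by rewrite /u; case: cid => p [].
  have u2 q : p2 (u q) = q2 q by rewrite /u; case: cid => p [].
  have uM : {morph u : a b / a \lhd b}.
    by move=> a b; apply: pI; rewrite ?u1 ?u2 !qhom_lhd ?u1 ?u2.
  have uMV : {morph u : a b / a \lhdV b}.
    by move=> a b; apply: pI; rewrite ?u1 ?u2 !qhom_lhdV ?u1 ?u2.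
  pose uh : {qhom Q -> P} := HB.pack u (isQuandleHom.Build Q P u uM uMV).
  exists uh; split=> [|v [/qhom_eqP v1 /qhom_eqP v2]].
    by split; apply/qhom_eqP => q; [apply: u1 | apply: u2].
  apply/qhom_eqP => q; apply: pI; first by rewrite [LHS]u1 -[LHS]v1.
  by rewrite [LHS]u2 -[LHS]v2.
Qed.

Lemma full_subcategory_pullback (C : category) (S : C -> Prop)
    (A B Z P : full_subcategory S) (f : hom A Z) (g : hom B Z)
    (p1 : hom P A) (p2 : hom P B) :
  @is_pullback C (sval A) (sval B) (sval Z) (sval P) f g p1 p2 ->
  is_pullback f g p1 p2.
Proof. by case=> pC pU; split=> // Q; apply: pU. Qed.

(** * Lifting products along a surjection by division *)

Section Lifting.
Variables (X Y : quandleType) (phi : {qhom X -> Y}).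
Hypothesis phi_surj : qsurjective phi.

(** After lifting [a] to [y], symmetry turns the equation for [z] into [z \lhd y = x], solved by
    [x \lhdV y]. *)
Lemma lift_lhd (x : X) (a b : Y) :
    symmetric_quandle X -> symmetric_quandle Y -> phi x = a \lhd b ->
  exists y z, [/\ x = y \lhd z, phi y = a & phi z = b].
Proof.
move=> symX symY phix; have [y phiy] := phi_surj a.
exists y, (x \lhdV y); split=> //; first by rewrite symX lhdVK.
by rewrite qhom_lhdV phix phiy symY lhdK.
Qed.

(** Here the second factor is lifted, and the first is found by right division, a quandle axiom. *)
Lemma lift_lhdV (x : X) (a b : Y) : phi x = a \lhdV b ->
  exists y z, [/\ x = y \lhdV z, phi y = a & phi z = b].
Proof.
move=> phix; have [z phiz] := phi_surj b.
by exists (x \lhd z), z; split; rewrite ?lhdK // qhom_lhd phix phiz lhdVK.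
Qed.

End Lifting.

(** * The congruence on [A] induced by a homomorphism [k] out of the pullback *)

Section PullbackKernel.
Variables (X Y : AbSymQnd) (A P : Qnd).
Variables (phi : hom (AbSymQnd_incl X) (AbSymQnd_incl Y)).
Variables (f : hom A (AbSymQnd_incl Y)).
Variables (p1 : hom P A) (p2 : hom P (AbSymQnd_incl X)).
Hypothesis phi_surj : qsurjective phi.
Hypothesis pb : is_pullback f phi p1 p2.

Let pC p : f (p1 p) = phi (p2 p).
Proof. by case/pullbackP: pb. Qed.

Let pI p p' : p1 p = p1 p' -> p2 p = p2 p' -> p = p'.
Proof. by case/pullbackP: pb => _ + _; apply. Qed.

Let pS a x : f a = phi x -> exists p, p1 p = a /\ p2 p = x.
Proof. by case/pullbackP: pb => _ _; apply. Qed.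

Let symX : symmetric_quandle (sval X). Proof. by case: (svalP X). Qed.
Let symY : symmetric_quandle (sval Y). Proof. by case: (svalP Y). Qed.
Let abX : abelian_quandle (sval X). Proof. by case: (svalP X). Qed.

Lemma pullback_lhd p a b : p1 p = a \lhd b ->
  exists q r, [/\ p = q \lhd r, p1 q = a & p1 r = b].
Proof.
move=> p1p; have := pC p; rewrite p1p qhom_lhd => /esym.
case/(lift_lhd phi_surj symX symY) => y [z [p2p phiy phiz]].
have [q [q1 q2]] := pS (esym phiy); have [r [r1 r2]] := pS (esym phiz).
by exists q, r; split=> //; apply: pI; rewrite qhom_lhd ?q1 ?q2 ?r1 ?r2.
Qed.

Lemma pullback_lhdV p a b : p1 p = a \lhdV b ->
  exists q r, [/\ p = q \lhdV r, p1 q = a & p1 r = b].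
Proof.
move=> p1p; have := pC p; rewrite p1p qhom_lhdV => /esym.
case/(lift_lhdV phi_surj) => y [z [p2p phiy phiz]].
have [q [q1 q2]] := pS (esym phiy); have [r [r1 r2]] := pS (esym phiz).
by exists q, r; split=> //; apply: pI; rewrite qhom_lhdV ?q1 ?q2 ?r1 ?r2.
Qed.

Lemma pullback_transport p a : f (p1 p) = f a -> exists q, p1 q = a /\ p2 q = p2 p.
Proof. by rewrite pC => /esym; apply: pS. Qed.

Variables (B : AbSymQnd) (k : {qhom P -> sval B}).

(** The first clause puts [a] and [a'] under the same elements of [X], so that [pullback_transport]
    can move points between their fibres. *)
Definition fibrewise_kernel (a a' : A) : Prop :=
  f a = f a' /\
  forall p p', p1 p = a -> p1 p' = a' -> p2 p = p2 p' -> k p = k p'.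

Lemma fibrewise_kernel_cong : congruence fibrewise_kernel.
Proof.
split.
- by move=> a; split=> // p p' <- e1 e2; congr (k _); apply: pI.
- move=> a b [fab kab]; split=> // p p' e1 e1' e2.
  by apply/esym/kab.
- move=> a b c [fab kab] [fbc kbc]; split=> [|p p' e1 e1' e2].
    by rewrite fab.
  (* Transitivity passes through the point over [b] with the same [X]-component as [p]. *)
  have [|q [q1 q2]] := @pullback_transport p b; first by rewrite e1.
  by rewrite (kab p q) // (kbc q p') // q2.
- move=> a a' b b' [fa ka] [fb kb]; split=> [|p p' e1 e1' e2].
    by rewrite !qhom_lhd fa fb.
  (* Factor [p] over [a] and [b], then move each factor over [a'] and [b'] with its [X]-component
     fixed; the product of the moved factors has the components of [p']. *)
  have [q [r [def_p q1 r1]]] := pullback_lhd e1.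
  have [|q' [q1' q2']] := @pullback_transport q a'; first by rewrite q1.
  have [|r' [r1' r2']] := @pullback_transport r b'; first by rewrite r1.
  have -> : p' = q' \lhd r'.
    by apply: pI; rewrite qhom_lhd ?q1' ?r1' // q2' r2' -e2 def_p qhom_lhd.
  by rewrite def_p !qhom_lhd (ka q q') // (kb r r').
- move=> a a' b b' [fa ka] [fb kb]; split=> [|p p' e1 e1' e2].
    by rewrite !qhom_lhdV fa fb.
  have [q [r [def_p q1 r1]]] := pullback_lhdV e1.
  have [|q' [q1' q2']] := @pullback_transport q a'; first by rewrite q1.
  have [|r' [r1' r2']] := @pullback_transport r b'; first by rewrite r1.
  have -> : p' = q' \lhdV r'.
    by apply: pI; rewrite qhom_lhdV ?q1' ?r1' // q2' r2' -e2 def_p qhom_lhdV.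
  by rewrite def_p !qhom_lhdV (ka q q') // (kb r r').
Qed.

Lemma fibrewise_kernel_symmetric a b : fibrewise_kernel (a \lhd b) (b \lhd a).
Proof.
split=> [|p p' e1 e1' e2]; first by rewrite !qhom_lhd symY.
(* Symmetry of [X] shows that swapping the factors of [p] gives [p']; then symmetry of [B] applies
   to the images under [k]. *)
have [q [r [def_p q1 r1]]] := pullback_lhd e1.
have -> : p' = r \lhd q.
  by apply: pI; rewrite qhom_lhd ?q1 ?r1 // -e2 def_p qhom_lhd symX.
by rewrite def_p !qhom_lhd; case: (svalP B) => _; apply.
Qed.

Lemma fibrewise_kernel_abelian a b c d :
  fibrewise_kernel ((a \lhd b) \lhd (c \lhd d)) ((a \lhd c) \lhd (b \lhd d)).
Proof.
split=> [|p p' e1 e1' e2].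
  by rewrite !qhom_lhd; case: (svalP Y) => + _; apply.
have [u [v [def_p u1 v1]]] := pullback_lhd e1.
have [q [r [def_u q1 r1]]] := pullback_lhd u1.
have [s [t [def_v s1 t1]]] := pullback_lhd v1.
have -> : p' = (q \lhd s) \lhd (r \lhd t).
  apply: pI; rewrite !qhom_lhd ?q1 ?r1 ?s1 ?t1 //.
  by rewrite -e2 def_p def_u def_v !qhom_lhd abX.
by rewrite def_p def_u def_v !qhom_lhd; case: (svalP B) => + _; apply.
Qed.

(** It is enough to test against one [D]: the quotient of [A] by [fibrewise_kernel]. *)
Lemma pullback_identified p p' :
    (forall (D : AbSymQnd) (h : {qhom A -> sval D}), h (p1 p) = h (p1 p')) ->
  p2 p = p2 p' -> k p = k p'.
Proof.
have [D [h hS]] := abelian_symmetric_quotient fibrewise_kernel_cong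
  fibrewise_kernel_symmetric fibrewise_kernel_abelian.
by move=> /(_ D h) /hS[_ kP]; apply: kP.
Qed.

End PullbackKernel.

(** * The unit of the reflection *)

Section Unit.
Variables (I : functor Qnd AbSymQnd) (adjI : adjunction I AbSymQnd_incl).

Definition adj_unit (A : Qnd) : {qhom A -> sval (I A)} :=
  adj adjI (idm (I A)).

Lemma adj_unitE (A : Qnd) (B : AbSymQnd) (g : hom (I A) B) a :
  adj adjI g a = g (adj_unit A a).
Proof.
have := adj_naturalr adjI (idm (I A)) g; rewrite compm1 => ->.
by [].
Qed.

Lemma adj_unit_natural (A B : Qnd) (h : hom A B) a :
  fmap I h (adj_unit A a) = adj_unit B (h a).
Proof.
rewrite -adj_unitE; have := adj_naturall adjI (idm (I B)) h.
by rewrite comp1m => ->.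
Qed.

Lemma adj_unit_factor (A : Qnd) (B : AbSymQnd) (h : {qhom A -> sval B}) :
  exists g : hom (I A) B, forall a, h a = g (adj_unit A a).
Proof.
have [g _ gK] := adj_bij adjI A B.
by exists (g h) => a; rewrite -adj_unitE gK.
Qed.

(** The identity of [X] factors through the unit, which is thus a split monomorphism. *)
Lemma adj_unit_inj (X : AbSymQnd) : injective (adj_unit (AbSymQnd_incl X)).
Proof.
have [g gE] := adj_unit_factor (idfun : {qhom sval X -> sval X}).
by move=> x y e; rewrite -[x]/(idfun x) gE e -gE.
Qed.

(** The concrete reflection has a surjective class map, and [I A] is a retract of it compatibly with
    the maps from [A]. *)
Lemma adj_unit_surj (A : Qnd) : qsurjective (adj_unit A).
Proof.
have [g gE] := @adj_unit_factor A (reflAbSym A) (@refl_class A).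
pose l : hom (reflAbSym A) (I A) := refl_lift (adj_unit A).
have lg : comp l g = idm (I A).
  (* Homomorphisms from [I A] to abelian symmetric quandles are determined by their composites with
     the unit. *)
  apply: (bij_inj (adj_bij adjI A (I A))); apply/qhom_eqP => a.
  rewrite [LHS]adj_unitE [RHS]adj_unitE.
  transitivity (l (g (adj_unit A a))); first by [].
  by rewrite -gE; apply: (@refl_liftE A (I A) (adj_unit A)).
move=> u; have /qhom_eqP/(_ u) lgu := lg.
have : exists a, refl_class a = g u.
  by move: (g u); apply: refl_ind => a; exists a.
case=> a ga; exists a; rewrite -[RHS]lgu.
transitivity (l (g u)); last by [].
by rewrite -ga; apply/esym/(@refl_liftE A (I A) (adj_unit A)).
Qed.

End Unit.

Theorem theorem3p10
    (I : functor Qnd AbSymQnd) (adjI : left_adjoint I AbSymQnd_incl)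
    (X Y : AbSymQnd) (A P : Qnd)
    (phi : hom (AbSymQnd_incl X) (AbSymQnd_incl Y)) (phi_surj : qsurjective phi)
    (f : hom A (AbSymQnd_incl Y)) (f_surj : qsurjective f)
    (p1 : hom P A) (p2 : hom P (AbSymQnd_incl X))
    (pb : is_pullback f phi p1 p2) :
  is_pullback (fmap I f) (fmap I phi) (fmap I p1) (fmap I p2).
Proof.
case: adjI => ad; have [pC pI pS] := (pullbackP _ _ _ _).1 pb.
apply: full_subcategory_pullback; apply/pullbackP; split.
- move=> u; have [p <-] := adj_unit_surj ad u.
  by rewrite !adj_unit_natural pC.
- move=> u u'; have [[p <-] [p' <-]] := (adj_unit_surj ad u, adj_unit_surj ad u').
  rewrite !adj_unit_natural => e1 /adj_unit_inj e2.
  (* Here [k] is the unit at [P]; every [h] factors through the unit at [A], where [e1] holds. *)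
  apply: (pullback_identified phi_surj pb) e2 => D h.
  by have [g gE] := adj_unit_factor ad h; rewrite !gE e1.
- move=> u v; have [[a <-] [x <-]] := (adj_unit_surj ad u, adj_unit_surj ad v).
  (* Injectivity of the unit at [Y] brings the equation back to [f a = phi x], so the original
     pullback supplies [p]. *)
  rewrite !adj_unit_natural => /adj_unit_inj /pS[p [p1p p2p]].
  by exists (adj_unit ad P p); rewrite !adj_unit_natural p1p p2p.
Qed.
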